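(* Let $a,b\in R^{WD}$, and let $a^{WD}$, $b^{WD}$ be WD inverses of $a$ and $b$ respectively. If $ab=ba=0$, $ab^{WD}=b^{WD}a=0$ and $a^{WD}b=ba^{WD}=0$, then $a+b$ is WD invertible and $a^{WD}+b^{WD}$ is a WD inverse of $a+b$, i.e. $(a+b)^{WD}=a^{WD}+b^{WD}$.
   Context: $R$ is a proper unital ring with involution: an associative ring with $1$ and a map $*:R\to R$ with $(a+b)^*=a^*+b^*$, $(ab)^*=b^*a^*$, $(a^* )^*=a$, such that $a^*a=0$ implies $a=0$. Weak Drazin (WD) inverse: $a\in R$ is WD invertible if there are $x\in R$ and a positive integer $k$ with $axa=a$, $a^{k+1}x=a^k$, $xa^{k+1}=a^k$. The least positive integer $k$ for which such an $x$ exists is the weak Drazin index $\mathrm{ind}(a)$; any $x$ satisfying the three equations with $k=\mathrm{ind}(a)$ is a WD inverse of $a$ (not unique in general), denoted $a^{WD}$. $R^{WD}$ is the set of WD invertible elements. *)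

(* Defs.v *)
From HB Require Import structures.
From mathcomp Require Import all_boot all_order all_algebra.

Set Implicit Arguments.
Unset Strict Implicit.
Unset Printing Implicit Defensive.

Import GRing.Theory.
Local Open Scope ring_scope.

Definition proper_involution (R : pzRingType) (star : R -> R) : Prop :=
  [/\ {morph star : u v / u + v},
      forall u v : R, star (u * v) = star v * star u,
      involutive star
    & forall u : R, star u * u = 0 -> u = 0].

Definition WD_equations (R : pzRingType) (k : nat) (a x : R) : Prop :=
  [/\ a * x * a = a, a ^+ k.+1 * x = a ^+ k & x * a ^+ k.+1 = a ^+ k].

Definition WD_invertible (R : pzRingType) (a : R) : Prop :=
  exists (x : R) (k : nat), (0 < k)%N /\ WD_equations k a x.

Definition WD_index (R : pzRingType) (a : R) (k : nat) : Prop :=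
  [/\ (0 < k)%N,
      exists x : R, WD_equations k a x
    & forall j : nat, (0 < j)%N ->
        (exists x : R, WD_equations j a x) -> (k <= j)%N].

(* WD inverses are not unique, so this is a relation; the exponent is required
   to be the weak Drazin index of a, not just any admissible one. *)
Definition WD_inverse (R : pzRingType) (a x : R) : Prop :=
  exists k : nat, WD_index a k /\ WD_equations k a x.

(* Main.v *)
(** Since [a] and [b] annihilate each other, [(a + b)^n = a^n + b^n] for [n > 0],
    and the WD equations for [a + b] and [aWD + bWD] hold at the maximum of the
    two indices.  Minimality of that maximum: if [z] satisfies the equations for
    [a + b] at exponent [j], multiplying them by [a aWD] on the left or [aWD a]
    on the right kills the [b]-part, so [a^(j+1) z = a^j = z a^(j+1)]; this
    forces [aWD] itself to satisfy the equations for [a] at exponent [j]. *)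
Require Import Defs.
From HB Require Import structures.
From mathcomp Require Import all_boot all_order all_algebra.

Set Implicit Arguments.
Unset Strict Implicit.
Unset Printing Implicit Defensive.

Import GRing.Theory.
Local Open Scope ring_scope.

Lemma exprSD_orthogonal (R : pzRingType) (a b : R) (n : nat) :
  a * b = 0 -> b * a = 0 -> (a + b) ^+ n.+1 = a ^+ n.+1 + b ^+ n.+1.
Proof.
move=> ab0 ba0; elim: n => [|n IHn]; first by rewrite !expr1.
rewrite exprSr IHn mulrDl !mulrDr -!exprSr.
by rewrite [a ^+ n.+1]exprSr [b ^+ n.+1]exprSr -!mulrA ab0 ba0 !mulr0 addr0 add0r.
Qed.

Lemma WD_equations_leq (R : pzRingType) (k m : nat) (a x : R) :
  (k <= m)%N -> WD_equations k a x -> WD_equations m a x.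
Proof.
move=> /subnKC <- [axa ax xa]; split=> //.
  by rewrite -addSn addnC exprD -mulrA ax -exprD addnC.
by rewrite -addSn exprD mulrA xa -exprD.
Qed.

(** Each further factor [z] cancels one further factor [a], so a^j can be traded for a multiple of
    an arbitrarily high power of [a]. *)
Lemma expr_absorbl (R : pzRingType) (j n : nat) (a z : R) :
  z * a ^+ j.+1 = a ^+ j -> z ^+ n * a ^+ (j + n) = a ^+ j.
Proof.
move=> za; elim: n => [|n IHn]; first by rewrite mul1r addn0.
by rewrite exprSr addnS -addSn exprD -mulrA (mulrA z) za -exprD.
Qed.

Lemma expr_absorbr (R : pzRingType) (j n : nat) (a z : R) :
  a ^+ j.+1 * z = a ^+ j -> a ^+ (j + n) * z ^+ n = a ^+ j.
Proof.
move=> az; elim: n => [|n IHn]; first by rewrite mulr1 addn0.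
rewrite exprS addnS -addSn addnC exprD -mulrA (mulrA _ z) az mulrA -exprD.
by rewrite addnC.
Qed.

(** The equations for [x] hold at exponent [j + k]. Since a^j = z^k a^(j+k) = a^(j+k) z^k,
    multiplying them by z^k on the outer side brings them down to [j]; [z] only lowers the
    exponent. *)
Lemma WD_equations_exponent (R : pzRingType) (k j : nat) (a x z : R) :
  WD_equations k a x -> a ^+ j.+1 * z = a ^+ j -> z * a ^+ j.+1 = a ^+ j ->
  WD_equations j a x.
Proof.
move=> ax_k az za.
have [axa ax xa] := WD_equations_leq (leq_addl j k) ax_k; split=> //.
- by rewrite exprSr -(expr_absorbl k za) -!mulrA (mulrA _ a) -exprSr ax.
- by rewrite exprS -(expr_absorbr k az) !mulrA -(mulrA x a) -exprS xa.
Qed.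

Lemma WD_equations_summand (R : pzRingType) (k j : nat) (a b x z : R) :
  a * b = 0 -> b * a = 0 -> x * b = 0 -> b * x = 0 -> WD_equations k a x ->
  (0 < j)%N -> WD_equations j (a + b) z -> WD_equations j a x.
Proof.
(* Positivity matters here: powers of [a + b] split into powers of [a] and [b] only from exponent 1
   on. *)
case: j => // j ab0 ba0 xb0 bx0 ax_k _ [_ sz zs].
have [axa _ _] := ax_k.
have axX n : a * x * (a + b) ^+ n.+1 = a ^+ n.+1.
  rewrite exprSD_orthogonal // mulrDr !exprS !mulrA axa -(mulrA a x b) xb0.
  by rewrite mulr0 mul0r addr0.
have Xxa n : (a + b) ^+ n.+1 * (x * a) = a ^+ n.+1.
  rewrite exprSD_orthogonal // mulrDl !exprSr -!mulrA (mulrA a x) axa.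
  by rewrite (mulrA b x) bx0 mul0r mulr0 addr0.
apply: (WD_equations_exponent (z := z) ax_k).
- by rewrite -axX -mulrA sz axX.
- by rewrite -Xxa mulrA zs Xxa.
Qed.

Lemma WD_equations_add (R : pzRingType) (m : nat) (a b x y : R) :
  a * b = 0 -> b * a = 0 -> a * y = 0 -> y * a = 0 -> x * b = 0 -> b * x = 0 ->
  (0 < m)%N -> WD_equations m a x -> WD_equations m b y ->
  WD_equations m (a + b) (x + y).
Proof.
case: m => // m ab0 ba0 ay0 ya0 xb0 bx0 _ [axa ax xa] [byb by_ yb].
split.
- rewrite (mulrDl a b) !(mulrDr _ x y) ay0 bx0 addr0 add0r mulrDl !mulrDr axa byb.
  by rewrite -(mulrA a x) xb0 -(mulrA b y a) ya0 !mulr0 addr0 add0r.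
- rewrite !exprSD_orthogonal // mulrDl !mulrDr ax by_.
  (* Peeling one factor off the right exposes [a * y] and [b * x] in the cross terms. *)
  by rewrite (exprSr a m.+1) (exprSr b m.+1) -!mulrA ay0 bx0 !mulr0 addr0 add0r.
- rewrite !exprSD_orthogonal // mulrDl !mulrDr xa yb.
  by rewrite (exprS a m.+1) (exprS b m.+1) !mulrA xb0 ya0 !mul0r addr0 add0r.
Qed.

Theorem theorem3p1 (R : pzRingType) (star : R -> R)
    (hstar : proper_involution star)
    (a b aWD bWD : R)
    (ha : WD_invertible a) (hb : WD_invertible b)
    (haWD : WD_inverse a aWD) (hbWD : WD_inverse b bWD)
    (hab : a * b = 0) (hba : b * a = 0)
    (habWD : a * bWD = 0) (hbWDa : bWD * a = 0)
    (haWDb : aWD * b = 0) (hbaWD : b * aWD = 0) :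
  WD_invertible (a + b) /\ WD_inverse (a + b) (aWD + bWD).
Proof.
have [k [[k_gt0 _ k_min] ax]] := haWD.
have [l [[l_gt0 _ l_min] by_]] := hbWD.
have m_gt0 : (0 < maxn k l)%N by rewrite leq_max k_gt0.
have sum_eqs : WD_equations (maxn k l) (a + b) (aWD + bWD).
  apply: WD_equations_add => //.
  - exact: WD_equations_leq (leq_maxl k l) ax.
  - exact: WD_equations_leq (leq_maxr k l) by_.
split; first by exists (aWD + bWD), (maxn k l).
exists (maxn k l); split=> //; split=> //; first by exists (aWD + bWD).
(* The maximum is at most [j] once each index is, so minimality is tested on [a] and [b]
   separately. *)
move=> j j_gt0 [z z_eqs]; rewrite geq_max; apply/andP; split.
- apply: k_min => //; exists aWD.
  exact: (WD_equations_summand hab hba haWDb hbaWD ax j_gt0 z_eqs).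
- apply: l_min => //; exists bWD.
  apply: (WD_equations_summand hba hab hbWDa habWD by_ j_gt0 (z := z)).
  by rewrite addrC.
Qed.
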